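(* The class $\mathcal{DM}$ of deterministic multipass languages is equal to the Boolean closure $\mathcal{BDC}$ of the class of deterministic context-free languages, and the class $\mathcal{NM}$ of nondeterministic multipass languages is equal to the class $\mathcal{PCF}$ of poly-context-free languages.
   Context: All alphabets are finite. $\mathcal{BDC}$: a language $L\subseteq\Sigma^*$ is in $\mathcal{BDC}$ if it belongs to the smallest family of subsets of $\Sigma^*$ containing the deterministic context-free languages over $\Sigma$ and closed under finite union, finite intersection and complement in $\Sigma^*$. $\mathcal{PCF}$: $L\subseteq\Sigma^*$ is poly-context-free if it is the intersection of finitely many context-free languages over $\Sigma$. Notation: $[k]=\{1,\dots,k\}$, $\varepsilon$ is the empty word, $\Sigma_\varepsilon=\Sigma\cup\{\varepsilon\}$, $\Gamma_\varepsilon=\Gamma\cup\{\varepsilon\}$. When a symbol $\gamma\in\Gamma_\varepsilon$ is said to be on top of the stack, $\gamma=\varepsilon$ means the stack is empty. A deterministic $k$-pass automaton ($k\ge 1$) is a tuple $M=([k],Q,\Sigma,\Gamma,\sharp,\delta,q_0,H_a,H_r)$ where $[k]$ is the pass-counter, $Q$ is a finite set of states, $q_0\in Q$ is the initial state, $\Sigma$ is the finite input alphabet, $\Gamma\supseteq\Sigma$ is the finite stack alphabet, $\sharp\notin\Sigma$ is the end-marker, and $H_a\neq H_r$ are halting (accepting, rejecting) states not in $Q$. On input $w\in\Sigma^*$ the machine processes $w\sharp$ from left to right $k$ times, starting the first pass in state $q_0$ at the beginning of the tape with empty stack. The transition function $\delta$ has three parts. (1) Not reading the end-marker: $\delta$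 assigns to $(j,q,\sigma,\gamma)\in[k]\times Q\times\Sigma_\varepsilon\times\Gamma_\varepsilon$ either an element of $Q\times\Gamma^*$ or nothing. If $\delta(j,q,\sigma,\gamma)=(q',\zeta)$ with $\sigma\in\Sigma$, then on pass $j$, in state $q$, reading $\sigma$, with $\gamma$ on top of the stack, the machine moves to state $q'$, replaces $\gamma$ by $\zeta$ and advances the input. If $\delta(j,q,\varepsilon,\gamma)=(q',\zeta)$ (an $\varepsilon$-transition), then, independently of the scanned input symbol, the machine moves to $q'$ and replaces $\gamma$ by $\zeta$ without advancing the input. No $\varepsilon$-transition is possible with empty stack. If $\delta(j,q,\varepsilon,\gamma)$ is defined then $\delta(j,q,\sigma,\gamma)$ is undefined for all $\sigma\in\Sigma$; for every $j,q,\gamma$ there is always either an $\varepsilon$-transition or transitions reading the input letter. The machine never has a choice: an available $\varepsilon$-transition is performed whatever symbol (including $\sharp$) is scanned. (2) Reading the end-marker on a pass $j<k$: $\delta(j,q,\sharp,\gamma)\in Q$ is the state in which the next pass starts; the reading head is reset to the beginning of the input, the stack is emptied and the pass-counter becomes $j+1$. (3) Reading the end-marker on pass $k$: $\delta(k,q,\sharp,\gamma)\in\{H_a,H_r\}$, and the machine halts in this state. $M$ accepts $w$ iff, started in $q_0$ with empty stack on $w\sharp$, it halts in $H_a$ at the end of its $k$-th pass; $L(M)$ is the set of accepted words. A deterministic multipass language is a language $L(M)$ for some deterministic $k$-pass automaton $M$, $k\ge1$; $\mathcal{DM}$ is the class of these. A nondeterministic $k$-pass automaton $M=([k],Q,\Sigma,\Gamma,\sharp,\delta,q_0,H_a,H_n)$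 is defined in the same way, with a no-decision halting state $H_n$ instead of $H_r$, except that: in (1) $\delta(j,q,\sigma,\gamma)$ is a finite (possibly empty) subset of $Q\times\Gamma^*$ from which the machine may choose any pair, both reading transitions and $\varepsilon$-transitions may be available simultaneously, the machine halts if no transition is available, and again no $\varepsilon$-transition is possible with empty stack; in (2) $\delta(j,q,\sharp,\gamma)$ is a subset of $Q$ from which any state may be chosen to begin the next pass; in (3) $\delta(k,q,\sharp,\gamma)\in\{H_a,H_n\}$. $M$ accepts $w$ iff some possible computation on $w\sharp$ halts in $H_a$. $\mathcal{NM}$ is the class of all languages $L(M)$ for nondeterministic $k$-pass automata $M$, $k\ge 1$ (nondeterministic multipass languages). *)

(* Defs.v *)
From Stdlib Require Import Relation_Operators.
From mathcomp Require Import all_boot.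
From mathcomp Require Import boolp classical_sets.

Set Implicit Arguments.
Unset Strict Implicit.
Unset Printing Implicit Defensive.

Local Open Scope classical_set_scope.

(* A language over the finite alphabet [A] is a term of type [set (seq A)].
   A pushdown stack is a sequence whose head is the top of the stack, and
   replacing the top symbol by the word [z] leaves the first letter of [z] on
   top.  [None : option A] stands for the empty word. *)

Record cfg (A : finType) := Cfg {
  cfg_nonterminal : finType;
  cfg_start : cfg_nonterminal;
  cfg_rules : seq (cfg_nonterminal * seq (cfg_nonterminal + A))
}.

Inductive cfg_step (A : finType) (G : cfg A) :
    seq (cfg_nonterminal G + A) -> seq (cfg_nonterminal G + A) -> Prop :=
| CfgStep X z u v : (X, z) \in cfg_rules G ->
    cfg_step (u ++ inl X :: v) (u ++ z ++ v).

Definition cfg_language (A : finType) (G : cfg A) : set (seq A) :=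
  [set w | clos_refl_trans _ (@cfg_step A G)
             [:: inl (cfg_start G)] [seq inr a | a <- w]].

Definition context_free (A : finType) : set (set (seq A)) :=
  [set L | exists G : cfg A, L = cfg_language G].

(* Deterministic pushdown automata with a bottom symbol, accepting by final
   state; epsilon-moves are allowed, also after the input has been read. *)
Record dpda (A : finType) := Dpda {
  dpda_state : finType;
  dpda_stack : finType;
  dpda_delta :
    dpda_state -> option A -> dpda_stack -> option (dpda_state * seq dpda_stack);
  dpda_start : dpda_state;
  dpda_bottom : dpda_stack;
  dpda_final : {set dpda_state};
  dpda_deterministic : forall q X, dpda_delta q None X <> None ->
    forall a, dpda_delta q (Some a) X = None
}.

Inductive dpda_step (A : finType) (M : dpda A) :
    dpda_state M * seq A * seq (dpda_stack M) ->
    dpda_state M * seq A * seq (dpda_stack M) -> Prop :=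
| DpdaRead q a v X s q' z : dpda_delta q (Some a) X = Some (q', z) ->
    dpda_step (q, a :: v, X :: s) (q', v, z ++ s)
| DpdaEps q v X s q' z : dpda_delta q None X = Some (q', z) ->
    dpda_step (q, v, X :: s) (q', v, z ++ s).

Definition dpda_language (A : finType) (M : dpda A) : set (seq A) :=
  [set w | exists q s, q \in dpda_final M /\
     clos_refl_trans _ (@dpda_step A M)
       (dpda_start M, w, [:: dpda_bottom M]) (q, [::], s)].

Definition deterministic_context_free (A : finType) : set (set (seq A)) :=
  [set L | exists M : dpda A, L = dpda_language M].

(* The members for [set0] and [setT] are the empty union and intersection. *)
Definition boolean_closed (A : finType) (C : set (set (seq A))) : Prop :=
  [/\ C set0, C setT, setU_closed C, setI_closed C
    & forall L, C L -> C (~` L)].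

Definition BDC (A : finType) : set (set (seq A)) :=
  smallest (@boolean_closed A) (@deterministic_context_free A).

Definition PCF (A : finType) : set (set (seq A)) :=
  [set L | exists (n : nat) (F : 'I_n -> set (seq A)),
     (forall i, context_free (F i)) /\ L = \bigcap_i F i].

(* Multipass automata.  An automaton with [n.+1] passes numbers them by
   ['I_n.+1], starting from 0; the passes other than the last are
   [widen_ord (leqnSn n) j] for [j : 'I_n], and such a pass is followed by
   pass [lift ord0 j].  In the argument [option stack] of the transition
   functions, [None] means that the stack is empty.  The input remaining to be
   read is [v : seq A]; [v = [::]] means that the end-marker is scanned.
   A halting state is a boolean: [true] is the accepting state, and [false] the
   rejecting (deterministic case) or no-decision (nondeterministic case) one. *)

Inductive mp_config (A : finType) (n : nat) (Q Gamma : finType) :=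
| Run of 'I_n.+1 & Q & seq A & seq Gamma
| Halt of bool.

Arguments Run {A n Q Gamma}.
Arguments Halt {A n Q Gamma}.

Record dma (A : finType) := Dma {
  dma_n : nat;
  dma_state : finType;
  dma_stack : finType;
  dma_letter : A -> dma_stack; (* the inclusion of [A] in the stack alphabet *)
  dma_letter_inj : injective dma_letter;
  dma_delta : 'I_dma_n.+1 -> dma_state -> option A -> option dma_stack ->
    option (dma_state * seq dma_stack);
  dma_next : 'I_dma_n -> dma_state -> option dma_stack -> dma_state;
  dma_halt : dma_state -> option dma_stack -> bool;
  dma_start : dma_state;
  dma_eps_nonempty : forall j q, dma_delta j q None None = None;
  dma_deterministic : forall j q g, dma_delta j q None g <> None ->
    forall a, dma_delta j q (Some a) g = None;
  dma_total : forall j q g, dma_delta j q None g = None ->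
    forall a, dma_delta j q (Some a) g <> None
}.

Inductive dma_step (A : finType) (M : dma A) (w : seq A) :
    mp_config A (dma_n M) (dma_state M) (dma_stack M) ->
    mp_config A (dma_n M) (dma_state M) (dma_stack M) -> Prop :=
| DmaRead j q a v s q' z : dma_delta j q (Some a) (ohead s) = Some (q', z) ->
    dma_step w (Run j q (a :: v) s) (Run j q' v (z ++ behead s))
| DmaEps j q v s q' z : dma_delta j q None (ohead s) = Some (q', z) ->
    dma_step w (Run j q v s) (Run j q' v (z ++ behead s))
| DmaNext (j : 'I_(dma_n M)) q s :
    dma_delta (widen_ord (leqnSn _) j) q None (ohead s) = None ->
    dma_step w (Run (widen_ord (leqnSn _) j) q [::] s)
               (Run (lift ord0 j) (dma_next j q (ohead s)) w [::])
| DmaHalt q s : dma_delta ord_max q None (ohead s) = None ->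
    dma_step w (Run ord_max q [::] s) (Halt (dma_halt q (ohead s))).

Definition dma_language (A : finType) (M : dma A) : set (seq A) :=
  [set w | clos_refl_trans _ (@dma_step A M w)
             (Run ord0 (dma_start M) w [::]) (Halt true)].

Definition DM (A : finType) : set (set (seq A)) :=
  [set L | exists M : dma A, L = dma_language M].

(* Finite sets of pairs (state, word) are given by lists of their elements.
   The end-marker may be read even if an epsilon-transition is available. *)
Record nma (A : finType) := Nma {
  nma_n : nat;
  nma_state : finType;
  nma_stack : finType;
  nma_letter : A -> nma_stack;
  nma_letter_inj : injective nma_letter;
  nma_delta : 'I_nma_n.+1 -> nma_state -> option A -> option nma_stack ->
    seq (nma_state * seq nma_stack);
  nma_next : 'I_nma_n -> nma_state -> option nma_stack -> {set nma_state};
  nma_halt : nma_state -> option nma_stack -> bool;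
  nma_start : nma_state;
  nma_eps_nonempty : forall j q, nma_delta j q None None = [::]
}.

Inductive nma_step (A : finType) (M : nma A) (w : seq A) :
    mp_config A (nma_n M) (nma_state M) (nma_stack M) ->
    mp_config A (nma_n M) (nma_state M) (nma_stack M) -> Prop :=
| NmaRead j q a v s q' z : (q', z) \in nma_delta j q (Some a) (ohead s) ->
    nma_step w (Run j q (a :: v) s) (Run j q' v (z ++ behead s))
| NmaEps j q v s q' z : (q', z) \in nma_delta j q None (ohead s) ->
    nma_step w (Run j q v s) (Run j q' v (z ++ behead s))
| NmaNext (j : 'I_(nma_n M)) q s q' : q' \in nma_next j q (ohead s) ->
    nma_step w (Run (widen_ord (leqnSn _) j) q [::] s)
               (Run (lift ord0 j) q' w [::])
| NmaHalt q s :
    nma_step w (Run ord_max q [::] s) (Halt (nma_halt q (ohead s))).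

Definition nma_language (A : finType) (M : nma A) : set (seq A) :=
  [set w | clos_refl_trans _ (@nma_step A M w)
             (Run ord0 (nma_start M) w [::]) (Halt true)].

Definition NM (A : finType) : set (set (seq A)) :=
  [set L | exists M : nma A, L = nma_language M].

Arguments BDC A : clear implicits.
Arguments PCF A : clear implicits.
Arguments DM A : clear implicits.
Arguments NM A : clear implicits.

(* Main.v *)
(* The words accepted from the beginning of pass j in state q are the union over
   q' of the words on which pass j leads from q to q' and which are accepted
   from the beginning of pass j+1 in state q'.  Since one pass is a pushdown
   computation, multipass languages are obtained from (deterministic)
   context-free languages by finite unions and intersections, and finite
   intersections of context-free languages are stable under finite unions by
   distributivity.

   Conversely, a nondeterministic automaton checks membership in one
   context-free language on each pass.  A Boolean combination of deterministic
   context-free languages is determined by finitely many membership bits, which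
   a deterministic automaton computes one per pass and stores in its state;
   this requires that no pass loops on epsilon-moves. *)

From Stdlib Require Import Relation_Operators.
Require Import Defs.
From mathcomp Require Import all_boot.
From mathcomp Require Import boolp classical_sets.

Set Implicit Arguments.
Unset Strict Implicit.
Unset Printing Implicit Defensive.

Local Open Scope classical_set_scope.

Lemma clos_rt_backward T (R : T -> T -> Prop) (P : T -> Prop) x y :
  (forall a b, R a b -> P b -> P a) -> clos_refl_trans _ R x y -> P y -> P x.
Proof.
by move=> PR; elim=> [a b /PR //|//|a b c _ IH1 _ IH2 Pc]; apply/IH1/IH2.
Qed.

Lemma clos_rt_cons T (R : T -> T -> Prop) x y z :
  R x y -> clos_refl_trans _ R y z -> clos_refl_trans _ R x z.
Proof. by move=> xy; apply: rt_trans; apply: rt_step. Qed.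

(** * Multipass computations and their passes *)

Section Pass.
Variables (A Q Gamma : finType).
Variable delta : Q -> option A -> option Gamma -> Q * seq Gamma -> Prop.
Variable K : Q -> option Gamma -> Prop.

(** One pass, [K] being the condition for a successful reading of the end-marker. Relations cover
    the deterministic and the nondeterministic case together. *)
Inductive pass_acc : Q -> seq A -> seq Gamma -> Prop :=
| PassEnd q s : K q (ohead s) -> pass_acc q [::] s
| PassRead q a v s q' z : delta q (Some a) (ohead s) (q', z) ->
    pass_acc q' v (z ++ behead s) -> pass_acc q (a :: v) s
| PassEps q v s q' z : delta q None (ohead s) (q', z) ->
    pass_acc q' v (z ++ behead s) -> pass_acc q v s.

End Pass.

Lemma pass_acc_sub (A Q Gamma : finType)
    (delta : Q -> option A -> option Gamma -> Q * seq Gamma -> Prop)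
    (K K' : Q -> option Gamma -> Prop) q v s :
  (forall q g, K q g -> K' q g) -> pass_acc delta K q v s -> pass_acc delta K' q v s.
Proof.
move=> KK'; elim=> {q v s} [q s /KK'|q a v s q' z d _ IH|q v s q' z d _ IH].
- exact: PassEnd.
- exact: PassRead d IH.
- exact: PassEps d IH.
Qed.

Section Multipass.
Variables (A Q Gamma : finType) (n : nat).
Variable delta :
  'I_n.+1 -> Q -> option A -> option Gamma -> Q * seq Gamma -> Prop.
Variable next : 'I_n -> Q -> option Gamma -> Q -> Prop.
Variable halt : Q -> option Gamma -> Prop.

Inductive mp_acc (w : seq A) : 'I_n.+1 -> Q -> seq A -> seq Gamma -> Prop :=
| MpRead j q a v s q' z : delta j q (Some a) (ohead s) (q', z) ->
    mp_acc w j q' v (z ++ behead s) -> mp_acc w j q (a :: v) s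
| MpEps j q v s q' z : delta j q None (ohead s) (q', z) ->
    mp_acc w j q' v (z ++ behead s) -> mp_acc w j q v s
| MpNext (j : 'I_n) q s q' : next j q (ohead s) q' ->
    mp_acc w (lift ord0 j) q' w [::] ->
    mp_acc w (widen_ord (leqnSn n) j) q [::] s
| MpHalt q s : halt q (ohead s) -> mp_acc w ord_max q [::] s.

Lemma widen_ord_neq_max (j : 'I_n) : widen_ord (leqnSn n) j <> ord_max.
Proof. by move=> /(congr1 val) /= jn; have := ltn_ord j; rewrite jn ltnn. Qed.

Lemma mp_acc_max w q v s :
  mp_acc w ord_max q v s <-> pass_acc (delta ord_max) halt q v s.
Proof.
split=> [|]; last first.
- elim=> {q v s} [q s|q a v s q' z d _ IH|q v s q' z d _ IH]; first exact: MpHalt.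
  + exact: MpRead d IH.
  + exact: MpEps d IH.
- move Ej: ord_max => j acc.
  elim: acc Ej => {j q v s} [j q a v s q' z d _ IH|j q v s q' z d _ IH|j q s q' _ _ _|
      q s h] Ej.
  + exact: PassRead d (IH Ej).
  + exact: PassEps d (IH Ej).
  + by case: (@widen_ord_neq_max j).
  + exact: PassEnd.
Qed.

(** At the end-marker the stack is emptied and the head reset, so the state [q'] is all that links
    one pass to the next. *)
Lemma mp_acc_widen w (j : 'I_n) q v s :
  mp_acc w (widen_ord (leqnSn n) j) q v s <->
  exists2 q', pass_acc (delta (widen_ord (leqnSn n) j))
                (fun p g => next j p g q') q v s
            & mp_acc w (lift ord0 j) q' w [::].
Proof.
split=> [|[q' acc w']]; last first.
- elim: acc => {q v s} [q s nx|q a v s q1 z d _ IH|q v s q1 z d _ IH].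
  + exact: MpNext nx w'.
  + exact: MpRead d IH.
  + exact: MpEps d IH.
- move Ej: (widen_ord _ j) => k acc.
  elim: acc Ej => {k q v s} [k q a v s q' z d _ IH|k q v s q' z d _ IH|k q s q' nx aw _|
      q s _] Ej.
  + have [q1 acc1 w1] := IH Ej.
    by exists q1 => //; apply: PassRead d acc1.
  + have [q1 acc1 w1] := IH Ej.
    by exists q1 => //; apply: PassEps d acc1.
  + have {}Ej : j = k by apply/val_inj; move/(congr1 val): Ej.
    by subst k; exists q' => //; apply: PassEnd.
  + by case: (@widen_ord_neq_max j).
Qed.

Definition mp_language (q : Q) : set (seq A) := [set w | mp_acc w ord0 q w [::]].

Lemma mp_language_in (C : set (set (seq A))) :
  C set0 -> setU_closed C -> setI_closed C ->
  (forall q, C [set w | pass_acc (delta ord_max) halt q w [::]]) ->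
  (forall j q q', C [set w | pass_acc (delta (widen_ord (leqnSn n) j))
                               (fun p g => next j p g q') q w [::]]) ->
  forall q, C (mp_language q).
Proof.
move=> C0 CU CI Chalt Cnext q.
have CbigU (L : Q -> set (seq A)) :
    (forall q', C (L q')) -> C [set w | exists q', L q' w].
  move=> CL; have -> : [set w | exists q', L q' w] =
      [set w | exists2 q', q' \in enum Q & L q' w].
    apply/seteqP; split=> w [q' Lq']; last by exists q'.
    by exists q' => //; rewrite mem_enum.
  elim: (enum Q) => [|q0 s IH].
    by rewrite (_ : [set w | _] = set0) //; apply/seteqP; split=> // w [].
  have -> : [set w | exists2 q', q' \in q0 :: s & L q' w] =
      L q0 `|` [set w | exists2 q', q' \in s & L q' w].
    apply/seteqP; split=> w.
      move=> [q' + Lq']; rewrite in_cons => /orP[/eqP<-|q's]; first by left.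
      by right; exists q'.
    move=> [Lq0|[q' q's Lq']]; first by exists q0 => //; rewrite mem_head.
    by exists q' => //; rewrite in_cons q's orbT.
  exact: CU.
(* Induction on the number [m] of passes that follow pass [j]. *)
suff H m : forall j : 'I_n.+1, j + m = n ->
    forall q, C [set w | mp_acc w j q w [::]] by apply: (H n); rewrite add0n.
elim: m => [|m IH] j jm {}q.
  have -> : j = ord_max by apply: ord_inj; rewrite -(addn0 j).
  have -> : [set w | mp_acc w ord_max q w [::]] =
      [set w | pass_acc (delta ord_max) halt q w [::]].
    by apply/seteqP; split=> w; rewrite /= mp_acc_max.
  exact: Chalt.
have jn : j < n by have := leq_addr m j.+1; rewrite addSnnS jm.
have -> : j = widen_ord (leqnSn n) (Ordinal jn) by apply/val_inj.
have -> : [set w | mp_acc w (widen_ord (leqnSn n) (Ordinal jn)) q w [::]] =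
    [set w | exists q',
      ([set w | pass_acc (delta (widen_ord (leqnSn n) (Ordinal jn)))
         (fun p g => next (Ordinal jn) p g q') q w [::]] `&`
       [set w | mp_acc w (lift ord0 (Ordinal jn)) q' w [::]]) w].
  apply/seteqP; split=> w /=.
    by move=> /mp_acc_widen[q' ? ?]; exists q'.
  by move=> [q' [? ?]]; apply/mp_acc_widen; exists q'.
apply: CbigU => q'; apply: CI => //.
by apply: IH; rewrite lift0 addSn -addnS.
Qed.

End Multipass.

(** A deterministic machine reads the end-marker only when no epsilon-move is available, which
    becomes part of the end conditions. *)
Lemma dma_languageE (A : finType) (M : dma A) :
  dma_language M =
  mp_language (fun j q a g p => dma_delta (d:=M) j q a g = Some p)
    (fun j q g q' => dma_delta (widen_ord (leqnSn _) j) q None g = None /\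
                     dma_next j q g = q')
    (fun q g => dma_delta ord_max q None g = None /\ dma_halt q g)
    (dma_start M).
Proof.
apply/seteqP; split=> w.
- move=> /= /(clos_rt_backward (P := fun c => match c with
    | Run j q v s => mp_acc (fun j q a g p => dma_delta (d:=M) j q a g = Some p)
        (fun j q g q' => dma_delta (widen_ord (leqnSn _) j) q None g = None /\
                         dma_next j q g = q')
        (fun q g => dma_delta ord_max q None g = None /\ dma_halt q g) w j q v s
    | Halt b => b end)); apply=> // _ _ [j q a v s q' z d|j q v s q' z d|j q s d|q s d].
  + exact: MpRead.
  + exact: MpEps.
  + exact: MpNext.
  + by move=> h; apply: MpHalt.
- suff H j q v s : mp_acc (fun j q a g p => dma_delta (d:=M) j q a g = Some p)
        (fun j q g q' => dma_delta (widen_ord (leqnSn _) j) q None g = None /\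
                         dma_next j q g = q')
        (fun q g => dma_delta ord_max q None g = None /\ dma_halt q g) w j q v s ->
      clos_refl_trans _ (@dma_step A M w) (Run j q v s) (Halt true) by exact: H.
  elim=> {j q v s} [j q a v s q' z d _|j q v s q' z d _|j q s _ [d <-] _|q s [d h]].
  + by apply: clos_rt_cons; apply: DmaRead.
  + by apply: clos_rt_cons; apply: DmaEps.
  + by apply: clos_rt_cons; apply: DmaNext.
  + by apply: rt_step; rewrite -[in Halt true]h; apply: DmaHalt.
Qed.

Lemma nma_languageE (A : finType) (M : nma A) :
  nma_language M =
  mp_language (fun j q a g p => p \in nma_delta (n:=M) j q a g)
    (fun j q g q' => q' \in nma_next j q g) (fun q g => nma_halt q g)
    (nma_start M).
Proof.
apply/seteqP; split=> w.
- move=> /= /(clos_rt_backward (P := fun c => match c with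
    | Run j q v s => mp_acc (fun j q a g p => p \in nma_delta (n:=M) j q a g)
        (fun j q g q' => q' \in nma_next j q g) (fun q g => nma_halt q g) w j q v s
    | Halt b => b end)); apply=> // _ _ [j q a v s q' z d|j q v s q' z d|j q s q' d|q s].
  + exact: MpRead.
  + exact: MpEps.
  + exact: MpNext.
  + by move=> h; apply: MpHalt.
- suff H j q v s : mp_acc (fun j q a g p => p \in nma_delta (n:=M) j q a g)
        (fun j q g q' => q' \in nma_next j q g) (fun q g => nma_halt q g) w j q v s ->
      clos_refl_trans _ (@nma_step A M w) (Run j q v s) (Halt true) by exact: H.
  elim=> {j q v s} [j q a v s q' z d _|j q v s q' z d _|j q s q' d _|q s h].
  + by apply: clos_rt_cons; apply: NmaRead.
  + by apply: clos_rt_cons; apply: NmaEps.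
  + by apply: clos_rt_cons; apply: NmaNext.
  + by apply: rt_step; rewrite -[in Halt true]h; apply: NmaHalt.
Qed.

(** * Context-free languages *)

Section Leftmost.
Variables (A : finType) (G : cfg A).

Inductive gen : seq (cfg_nonterminal G + A) -> seq A -> Prop :=
| GenNil : gen [::] [::]
| GenLetter a x w : gen x w -> gen (inr a :: x) (a :: w)
| GenRule X z x w : (X, z) \in cfg_rules G -> gen (z ++ x) w ->
    gen (inl X :: x) w.

Lemma gen_letters w : gen [seq inr a | a <- w] w.
Proof. by elim: w => [|a w IH]; [apply: GenNil | apply: GenLetter]. Qed.

(** The rewritten occurrence is either at the front, where it is the next leftmost step, or behind a
    symbol that is treated first without affecting it. *)
Lemma gen_cfg_step x y w : cfg_step x y -> gen y w -> gen x w.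
Proof.
case=> {x y} X z u v Xz; move Ey: (u ++ z ++ v) => y gy.
elim: gy u Ey => {y w} [|a y w gy IH|Y z' y w Yz' gy IH] [|b u] //= Ey.
- by apply: GenRule Xz _; rewrite Ey; apply: GenNil.
- by apply: GenRule Xz _; rewrite Ey; apply: GenLetter.
- by case: Ey => -> /IH; apply: GenLetter.
- by apply: GenRule Xz _; rewrite Ey; apply: GenRule Yz' gy.
- case: Ey => -> Ey; apply: GenRule Yz' _; rewrite catA; apply: IH.
  by rewrite -catA Ey.
Qed.

Lemma cfg_steps_cons c x y :
  clos_refl_trans _ (@cfg_step A G) x y ->
  clos_refl_trans _ (@cfg_step A G) (c :: x) (c :: y).
Proof.
elim=> {x y} [_ _ [X z u v Xz]|x|x y z _ IH1 _ IH2].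
- by apply: rt_step; apply: (@CfgStep _ G X z (c :: u)).
- exact: rt_refl.
- exact: rt_trans IH1 IH2.
Qed.

Lemma gen_derives x w :
  gen x w <-> clos_refl_trans _ (@cfg_step A G) x [seq inr a | a <- w].
Proof.
split=> [|xw]; last first.
  apply: (clos_rt_backward (P := gen^~ w)) xw (gen_letters w) => ? ?.
  exact: gen_cfg_step.
elim=> {x w} [|a x w _ IH|X z x w Xz _ IH].
- exact: rt_refl.
- exact: cfg_steps_cons.
- by apply: clos_rt_cons IH; apply: (@CfgStep _ G X z [::]).
Qed.

Lemma cfg_languageE : cfg_language G = [set w | gen [:: inl (cfg_start G)] w].
Proof. by apply/seteqP; split=> w /=; rewrite gen_derives. Qed.

End Leftmost.

Lemma context_freeP (A : finType) (L : set (seq A)) :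
  context_free L <-> exists G : cfg A, L = [set w | gen [:: inl (cfg_start G)] w].
Proof. by split=> -[G ->]; exists G; rewrite cfg_languageE. Qed.

Lemma context_free_setT (A : finType) : context_free [set: seq A].
Proof.
pose G := Cfg tt ((tt, [::]) :: [seq (tt, [:: inr a; inl tt]) | a <- enum A]).
apply/context_freeP; exists G; apply/seteqP; split=> // w _ /=.
elim: w => [|a w IH].
  by apply: (@GenRule _ G _ [::]); [rewrite mem_head | apply: GenNil].
apply: (@GenRule _ G _ [:: inr a; inl tt]); last exact: GenLetter.
by rewrite in_cons map_f ?mem_enum.
Qed.

Lemma context_free_set0 (A : finType) : context_free (@set0 (seq A)).
Proof.
apply/context_freeP; exists (Cfg tt [::]); apply/seteqP; split=> // w /= gw.
by inversion gw.
Qed.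

(** * Disjoint unions of grammars *)

Section SumGrammar.
Variables (A I : finType) (G : I -> cfg A).

(** [None] is a fresh start symbol. The sum serves for unions, and for storing all grammars of an
    intersection in one. *)
Definition sum_nonterminal := option {i : I & cfg_nonterminal (G i)}.

Definition sum_start i : sum_nonterminal :=
  Some (Tagged (fun i => cfg_nonterminal (G i)) (cfg_start (G i))).

Definition sum_symbol i (x : cfg_nonterminal (G i) + A) : sum_nonterminal + A :=
  match x with
  | inl X => inl (Some (Tagged (fun i => cfg_nonterminal (G i)) X))
  | inr a => inr a
  end.

Definition sum_cfg : cfg A :=
  Cfg (None : sum_nonterminal)
    ([seq (None, [:: inl (sum_start i)]) | i <- enum I] ++
     [seq (Some (Tagged (fun i => cfg_nonterminal (G i)) r.1),
           map (@sum_symbol i) r.2) | i <- enum I, r <- cfg_rules (G i)]).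

(** The tag of a nonterminal names its grammar, so only rules of [G i] apply to the image of [x]. *)
Lemma gen_sum_symbol i x w :
  gen (map (@sum_symbol i) x : seq (cfg_nonterminal sum_cfg + A)) w <-> gen x w.
Proof.
split=> [|gx].
- move Ey: (map _ x) => y gy.
  elim: gy x Ey => {y w} [|a y w gy IH|Y z' y w Yz' gy IH] [|[X|b] x] //=.
  + by move=> _; apply: GenNil.
  + by case=> -> /IH; apply: GenLetter.
  + case=> EX Ey; subst Y y; move: Yz'; rewrite mem_cat => /orP[/mapP[] //|].
    move=> /allpairsPdep[k [[X' z] [_ Xz /= [ik]]]].
    subst k => /eqP; rewrite -tag_eqE /tag_eq /= eqxx tagged_asE /= => /eqP EX Ez.
    by apply: (@GenRule _ _ _ z); rewrite ?EX //; apply: IH; rewrite map_cat Ez.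
- elim: gx => {x w} [|a x w gx IH|X z x w Xz gx IH] /=.
  + exact: GenNil.
  + exact: GenLetter.
  + apply: (@GenRule _ sum_cfg _ (map (@sum_symbol i) z)); last by rewrite -map_cat.
    rewrite mem_cat; apply/orP; right; apply/allpairsPdep.
    by exists i, (X, z); rewrite mem_enum.
Qed.

Lemma gen_sum_start i w :
  gen [:: inl (sum_start i : cfg_nonterminal sum_cfg)] w <->
  gen [:: inl (cfg_start (G i))] w.
Proof. exact: (gen_sum_symbol [:: inl (cfg_start (G i))]). Qed.

Lemma gen_sum_cfg w :
  gen [:: inl (cfg_start sum_cfg)] w <->
  exists i, gen [:: inl (cfg_start (G i))] w.
Proof.
split=> [g|[i gi]]; last first.
  apply: (@GenRule _ sum_cfg _ [:: inl (sum_start i)]).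
    by rewrite mem_cat map_f ?mem_enum.
  by apply/gen_sum_start.
inversion g as [| |X z x w' Xz gz]; subst.
move: Xz; rewrite mem_cat => /orP[|/allpairsPdep[? [? [? ? []]]] //].
by move=> /mapP[i _ [Ez]]; exists i; apply/gen_sum_start; move: gz; rewrite Ez.
Qed.

End SumGrammar.

Lemma context_free_setU (A : finType) : setU_closed (@context_free A).
Proof.
move=> K L /context_freeP[GK ->] /context_freeP[GL ->].
apply/context_freeP; exists (sum_cfg (fun b : bool => if b then GK else GL)).
apply/seteqP; split=> w /=; rewrite gen_sum_cfg.
  by case=> ?; [exists true | exists false].
by move=> [[] ?]; [left | right].
Qed.

(** * Closure properties of poly-context-free languages *)

Lemma PCF_fin (A I : finType) (F : I -> set (seq A)) :
  (forall i, context_free (F i)) -> PCF A (\bigcap_i F i).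
Proof.
move=> CF; exists #|I|, (F \o enum_val); split=> [i|]; first exact: CF.
apply/seteqP; split=> w Fw i _ /=; first exact: Fw.
by have := Fw (enum_rank i) Logic.I; rewrite /= enum_rankK.
Qed.

Lemma PCF_context_free (A : finType) (L : set (seq A)) :
  context_free L -> PCF A L.
Proof.
move=> CL; have -> : L = \bigcap_(i in [set: unit]) L.
  by apply/seteqP; split=> w Lw; [move=> ? | exact: (Lw tt)].
exact: PCF_fin.
Qed.

Lemma PCF_setI (A : finType) : setI_closed (PCF A).
Proof.
move=> _ _ [m [F [CF ->]]] [n [G [CG ->]]].
have -> : \bigcap_i F i `&` \bigcap_i G i =
    \bigcap_i (match i : 'I_m + 'I_n with inl i => F i | inr i => G i end).
  apply/seteqP; split=> w; first by move=> [Fw Gw] [i|i] _; [apply: Fw|apply: Gw].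
  by move=> FGw; split=> i _; [apply: (FGw (inl i))|apply: (FGw (inr i))].
by apply: PCF_fin => -[].
Qed.

Lemma PCF_setU (A : finType) : setU_closed (PCF A).
Proof.
move=> _ _ [m [F [CF ->]]] [n [G [CG ->]]].
have -> : \bigcap_i F i `|` \bigcap_i G i =
    \bigcap_i (F (i : 'I_m * 'I_n).1 `|` G i.2).
  apply/seteqP; split=> w.
    by move=> [Fw|Gw] i _; [left; apply: Fw|right; apply: Gw].
  (* If [w] lies outside some [F i], the pairs [(i, j)] with this [i] put it in every [G j]. *)
  move=> FGw; have [Fw|/existsNP[i /not_implyP[_ nFw]]] := EM ((\bigcap_i F i) w).
    by left.
  by right=> j _; have [] := FGw (i, j) Logic.I.
by apply: PCF_fin => -[i j]; apply: context_free_setU.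
Qed.

(** * Nondeterministic multipass languages are poly-context-free *)

Section Marked.
Variable Gamma : finType.
Implicit Type s z : seq Gamma.

(* The marker [None] below the stack makes the empty stack visible to automata
   and grammars that only act on a topmost symbol. *)
Definition marked s : seq (option Gamma) := rcons (map some s) None.

Definition marked_push (g : option Gamma) z : seq (option Gamma) :=
  if g is Some _ then map some z else marked z.

Lemma marked_ohead s : marked s = ohead s :: behead (marked s).
Proof. by case: s. Qed.

(** On the empty stack the move consumes the marker, and [marked_push] puts it back below [z]. *)
Lemma marked_cat s z :
  marked (z ++ behead s) = marked_push (ohead s) z ++ behead (marked s).
Proof. by case: s => [|X s]; rewrite /marked /= ?cats0 // map_cat rcons_cat. Qed.

End Marked.

(* The classical triple construction.  A nonterminal [(p, g, Some q)] derives the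
   words read between state [p] with topmost symbol [g] and the moment that [g]
   has been popped, in state [q]; a nonterminal [(p, g, None)] derives the words
   read from [p] until acceptance while [g] is never popped. *)
Section Triples.
Variables (A Q Gamma : finType).
Variable d : Q -> option A -> option Gamma -> seq (Q * seq Gamma).
Variable K : Q -> option Gamma -> Prop.

Let N : finType := (Q * option Gamma * option Q)%type.

(** The intermediate states are guessed. For [o = None] the word ends with the symbol that is never
    popped and omits those below it. *)
Fixpoint chains (p : Q) (z : seq (option Gamma)) (o : option Q) : seq (seq N) :=
  match z with
  | [::] => if o == Some p then [:: [::]] else [::]
  | Y :: z' => [seq (p, Y, Some r) :: c | r <- enum Q, c <- chains r z' o] ++
               (if o == None then [:: [:: (p, Y, None)]] else [::])
  end.

Lemma chains_consP p Y z o c :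
  c \in chains p (Y :: z) o <->
  (exists r c', c = (p, Y, Some r) :: c' /\ c' \in chains r z o) \/
  (o = None /\ c = [:: (p, Y, None)]).
Proof.
rewrite /= mem_cat; split.
  case/orP=> [/allpairsPdep[r [c' [_ cc ->]]]|]; first by left; exists r, c'.
  by case: o => //=; rewrite inE => /eqP; right.
case=> [[r [c' [-> cc]]]|[-> ->]]; last by rewrite inE eqxx orbT.
by apply/orP; left; apply/allpairsPdep; exists r, c'; rewrite mem_enum.
Qed.

Lemma chains_cat p y z o r c c' :
  c \in chains p y (Some r) -> c' \in chains r z o -> c ++ c' \in chains p (y ++ z) o.
Proof.
elim: y p c => [|Y y IH] p c.
  by rewrite /=; case: eqP => // -[<-]; rewrite inE => /eqP->.
move=> /chains_consP[[q [c1 [-> cc1]]]|[//]] cc'.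
by apply/chains_consP; left; exists q, (c1 ++ c'); split; last exact: IH.
Qed.

Lemma chains_catl p y z c :
  c \in chains p y None -> c \in chains p (y ++ z) None.
Proof.
elim: y p c => [|Y y IH] p c // /chains_consP[[q [c1 [-> cc1]]]|[_ ->]].
  by apply/chains_consP; left; exists q, c1; split; last exact: IH.
by apply/chains_consP; right.
Qed.

Lemma chains_split p y z o c :
  c \in chains p (y ++ z) o ->
  (exists r c1 c2, [/\ c = c1 ++ c2, c1 \in chains p y (Some r)
                     & c2 \in chains r z o]) \/
  (o = None /\ c \in chains p y None).
Proof.
elim: y p c => [|Y y IH] p c.
  by left; exists p, [::], c; split=> //=; rewrite eqxx inE.
move=> /chains_consP[[q [c' [-> /IH]]]|[-> ->]]; last first.
  by right; split=> //; apply/chains_consP; right.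
case=> [[r [c1 [c2 [-> cc1 cc2]]]]|[-> cc']]; last first.
  by right; split=> //; apply/chains_consP; left; exists q, c'.
left; exists r, ((p, Y, Some q) :: c1), c2; split=> //.
by apply/chains_consP; left; exists q, c1.
Qed.

Definition triple_rhs (X : N) : seq (seq (N + A)) :=
  let: (p, g, o) := X in
  (if (o == None) && `[< K p g >] then [:: [::]] else [::]) ++
  flatten [seq [seq oapp (fun a => [:: inr a]) [::] a ++ map inl c
               | m <- d p a g, c <- chains m.1 (marked_push g m.2) o]
          | a <- enum {: option A}].

Definition triple_cfg (q : Q) : cfg A :=
  Cfg ((q, None, None) : N) [seq (X, x) | X <- enum N, x <- triple_rhs X].

Lemma triple_ruleP q0 p g o x :
  (((p, g, o) : cfg_nonterminal (triple_cfg q0)), x) \in cfg_rules (triple_cfg q0) <->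
  [/\ o = None, K p g & x = [::]] \/
  exists a q z c, [/\ (q, z) \in d p a g, c \in chains q (marked_push g z) o
    & x = oapp (fun a => [:: inr a]) [::] a ++ map inl c].
Proof.
have -> : (((p, g, o) : cfg_nonterminal (triple_cfg q0)), x) \in cfg_rules (triple_cfg q0)
    = (x \in triple_rhs (p, g, o)).
  apply/allpairsPdep/idP => [[X [y [_ yX [-> ->]]]] //|xX].
  by exists (p, g, o), x; rewrite mem_enum.
rewrite mem_cat; split.
  case/orP=> [|/flatten_mapP[a _ /allpairsPdep[[q z] [c [dz cc ->]]]]].
    by case: o => [o|] //=; case: asboolP => // Kp; rewrite inE => /eqP->; left.
  by right; exists a, q, z, c.
case=> [[-> Kp ->]|[a [q [z [c [dz cc ->]]]]]]; apply/orP.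
  by left; rewrite eqxx /=; case: asboolP => //; rewrite inE.
right; apply/flatten_mapP; exists a; first by rewrite mem_enum.
by apply/allpairsPdep; exists (q, z), c.
Qed.

Let delta p a g m := m \in d p a g.

(** The induction needs the optional letter [a] in front: a rule puts the letter it reads before the
    chain, and the next derivation step removes it. *)
Lemma gen_chain q0 a x w :
  gen (x : seq (cfg_nonterminal (triple_cfg q0) + A)) w ->
  forall c p s, x = oapp (fun a => [:: inr a]) [::] a ++ map inl c ->
  c \in chains p (marked s) None ->
  exists2 v, w = oapp (fun a => [:: a]) [::] a ++ v & pass_acc delta K p v s.
Proof.
move=> gx; elim: gx a => {x w} [|b x w _ IH|X z x w Xz gzx IH] a c p s.
- by case: a => //; case: c => // _; rewrite marked_ohead => /chains_consP[[? [? []]]|[]].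
- case: a => [a|]; last by case: c.
  by case=> <- Ex /(IH None _ _ _ Ex)[v -> acc]; exists v.
- case: a => //; case: c => //= Y c [<-] Ex.
  rewrite marked_ohead => /chains_consP[].
  + move=> [r [c' [[EX <-] cc]]]; rewrite {}EX in Xz.
    move: Xz => /triple_ruleP[[]//|[a [q [z' [c1 [dz cc1 Ez]]]]]].
    have {}cc := chains_cat cc1 cc; rewrite -marked_cat in cc.
    have [|v -> acc] := IH a _ _ _ _ cc; first by rewrite Ez Ex map_cat catA.
    exists (oapp (fun a => [:: a]) [::] a ++ v) => //.
    by case: a dz {Ez} => [a|] dz /=; [apply: PassRead dz acc | apply: PassEps dz acc].
  + move=> [_ [EX Ec]]; rewrite {}EX in Xz.
    move: Ex IH gzx; rewrite {}Ec => -> IH gzx.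
    move: Xz => /triple_ruleP[[_ Kp Ez]|[a [q [z' [c1 [dz cc1 Ez]]]]]].
      move: gzx; rewrite Ez => g; inversion g; exists [::] => //.
      exact: PassEnd.
    (* The chain omits the symbols below one that is never popped; they are restored to match the
       actual stack. *)
    have cc2 := chains_catl (behead (marked s)) cc1; rewrite -marked_cat in cc2.
    have [|v -> acc] := IH a _ _ _ _ cc2; first by rewrite Ez cats0.
    exists (oapp (fun a => [:: a]) [::] a ++ v) => //.
    by case: a dz {Ez} => [a|] dz /=; [apply: PassRead dz acc | apply: PassEps dz acc].
Qed.

Lemma pass_acc_chain q0 p w s :
  pass_acc delta K p w s ->
  exists2 c, c \in chains p (marked s) None &
    gen (map inl c : seq (cfg_nonterminal (triple_cfg q0) + A)) w.
Proof.
(* Undoes one move: the part of the chain that belongs to the pushed word becomes the right-hand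
   side of a rule for [g], popped in [r'] or never popped. *)
have step q g a z y r c v : (r, z) \in d q a g ->
    c \in chains r (marked_push g z ++ y) None ->
    gen (map inl c : seq (cfg_nonterminal (triple_cfg q0) + A)) v ->
    exists2 c', c' \in chains q (g :: y) None &
      gen (map inl c' : seq (cfg_nonterminal (triple_cfg q0) + A))
        (oapp (fun a => [:: a]) [::] a ++ v).
  move=> dz /chains_split cc gc.
  have gac : gen (oapp (fun a => [:: inr a]) [::] a ++ map inl c :
      seq (cfg_nonterminal (triple_cfg q0) + A)) (oapp (fun a => [:: a]) [::] a ++ v).
    by case: (a) => //= b; apply: GenLetter.
  case: cc => [[r' [c1 [c2 [Ec cc1 cc2]]]]|[_ cc]].
  - exists ((q, g, Some r') :: c2); first by apply/chains_consP; left; exists r', c2.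
    apply: (@GenRule _ (triple_cfg q0) _ (oapp (fun a => [:: inr a])
        [::] a ++ map inl c1)).
      by apply/triple_ruleP; right; exists a, r, z, c1.
    by move: gac; rewrite Ec map_cat catA.
  - exists [:: (q, g, None)]; first by apply/chains_consP; right.
    apply: (@GenRule _ (triple_cfg q0) _ (oapp (fun a => [:: inr a])
        [::] a ++ map inl c)).
      by apply/triple_ruleP; right; exists a, r, z, c.
    by rewrite cats0.
elim=> {p w s} [p s Kp|p a v s q z dz _ [c cc gc]|p v s q z dz _ [c cc gc]].
- exists [:: (p, ohead s, None)].
    by rewrite marked_ohead; apply/chains_consP; right.
  apply: (@GenRule _ (triple_cfg q0) _ [::]); last exact: GenNil.
  by apply/triple_ruleP; left.
- by rewrite marked_ohead; apply: step dz _ gc; rewrite -marked_cat.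
- by rewrite marked_ohead; apply: step dz _ gc; rewrite -marked_cat.
Qed.

(** The initial stack is the marker alone, whence the start symbol [(q0, None, None)]. *)
Lemma context_free_pass q0 :
  context_free [set w | pass_acc delta K q0 w [::]].
Proof.
apply/context_freeP; exists (triple_cfg q0); apply/seteqP; split=> w /=.
  case/(pass_acc_chain q0) => c /chains_consP[[r [c' [_]]] //|[_ ->]].
  exact.
move=> g; have [||v -> //] := @gen_chain q0 None _ _ g [:: (q0, None, None)] q0
    [::] => //.
by apply/chains_consP; right.
Qed.

End Triples.

Lemma NM_PCF (A : finType) : NM A `<=` PCF A.
Proof.
move=> _ [M ->]; rewrite nma_languageE; apply: mp_language_in => [|||q|j q q'].
- exact/PCF_context_free/context_free_set0.
- exact: PCF_setU.
- exact: PCF_setI.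
- exact/PCF_context_free/context_free_pass.
- exact/PCF_context_free/context_free_pass.
Qed.

(** * Poly-context-free languages are nondeterministic multipass *)

(* On each pass a leftmost derivation is guessed on the stack.  The start symbol
   can only be pushed while the first letter is read, so that letter is kept in
   the state ([Some (Some a)]) until the derivation produces it. *)
Section Leftmost_automaton.
Variables (A : finType) (G : cfg A) (n : nat).
Variable S : 'I_n.+1 -> cfg_nonterminal G.

Definition leftmost_delta (j : 'I_n.+1) (q : option (option A)) (a : option A)
    (g : option (cfg_nonterminal G + A)) :
    seq (option (option A) * seq (cfg_nonterminal G + A)) :=
  match q, a, g with
  | None, Some a, None => [:: (Some (Some a), [:: inl (S j)])]
  | Some _, None, Some (inl X) => [seq (q, r.2) | r <- cfg_rules G & r.1 == X]
  | Some (Some b), None, Some (inr c)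
  | Some None, Some b, Some (inr c) =>
      if b == c then [:: (Some None, [::])] else [::]
  | _, _, _ => [::]
  end.

(** The empty word has no first letter on which to push the start symbol, so the end condition of
    the initial state settles its membership. *)
Definition leftmost_end (j : 'I_n.+1) (q : option (option A))
    (g : option (cfg_nonterminal G + A)) : bool :=
  match q, g with
  | None, None => `[< gen [:: inl (S j)] [::] >]
  | Some None, None => true
  | _, _ => false
  end.

Definition leftmost_nma : nma A.
Proof.
refine (@Nma A n (option (option A)) (cfg_nonterminal G + A)%type inr _
  leftmost_delta
  (fun j q g => finset (fun q' =>
     leftmost_end (widen_ord (leqnSn n) j) q g && (q' == None)))
  (leftmost_end ord_max) None _).
- by move=> a b [].
- by move=> j [[b|]|].
Defined.

Let delta j q a g m := m \in leftmost_delta j q a g.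

Definition leftmost_val (j : 'I_n.+1) (q : option (option A)) v
    (x : seq (cfg_nonterminal G + A)) : Prop :=
  match q with
  | None => x = [::] /\ gen [:: inl (S j)] v
  | Some None => gen x v
  | Some (Some a) => gen x (a :: v)
  end.

Lemma leftmost_end_val j q x : leftmost_end j q (ohead x) -> leftmost_val j q [::] x.
Proof.
case: q x => [[b|]|] [|X x] //=; last by move/asboolP.
by move=> _; apply: GenNil.
Qed.

Lemma leftmost_read_val j q a v x q' z : delta j q (Some a) (ohead x) (q', z) ->
  leftmost_val j q' v (z ++ behead x) -> leftmost_val j q (a :: v) x.
Proof.
rewrite /delta; case: q x => [[b|]|] [|[X|c] x] //=.
- case: eqP => // ->; rewrite inE => /eqP[-> ->]; exact: GenLetter.
- by rewrite inE => /eqP[-> ->].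
Qed.

Lemma leftmost_eps_val j q v x q' z : delta j q None (ohead x) (q', z) ->
  leftmost_val j q' v (z ++ behead x) -> leftmost_val j q v x.
Proof.
rewrite /delta; case: q x => [b|] [|[X|c] x] //=.
- by case: b.
- have -> : match b with | Some _ | _ =>
    [seq (Some b, r.2) | r <- cfg_rules G & r.1 == X] end
    = [seq (Some b, r.2) | r <- cfg_rules G & r.1 == X] by case: b.
  case/mapP => -[Y z']; rewrite mem_filter => /andP[/eqP /= -> Xz] [-> ->].
  by case: b => [b|] /=; apply: GenRule Xz.
- case: b => // b; case: eqP => // ->; rewrite inE => /eqP[-> ->]; exact: GenLetter.
Qed.

Lemma leftmost_run j x v : gen x v ->
  pass_acc (delta j) (leftmost_end j) (Some None) v x.
Proof.
elim=> {x v} [|a x v _ IH|X z x v Xz _ IH].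
- exact: PassEnd.
- by apply: (PassRead (s := inr a :: x) (z := [::]) _ IH); rewrite /delta /= eqxx inE.
- apply: (PassEps (s := inl X :: x) _ IH); apply/mapP; exists (X, z) => //.
  by rewrite mem_filter eqxx.
Qed.

(** Rules are applied while [a] waits in the state; once [a] is on top, an epsilon-move removes both
    and [leftmost_run] takes over. *)
Lemma leftmost_buffer j a x v : gen x (a :: v) ->
  pass_acc (delta j) (leftmost_end j) (Some (Some a)) v x.
Proof.
move Ew: (a :: v) => w gx; elim: gx Ew => {x w} [|b x w gx _|X z x w Xz _ IH] //.
- move=> [-> ->]; apply: (PassEps (s := inr b :: x) (z := [::]) _ (leftmost_run j gx)).
  by rewrite /delta /= eqxx inE.
- move=> /IH {}IH; apply: (PassEps (s := inl X :: x) _ IH); apply/mapP;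
    exists (X, z) => //.
  by rewrite mem_filter eqxx.
Qed.

Lemma leftmost_pass j w : gen [:: inl (S j)] w ->
  pass_acc (delta j) (leftmost_end j) None w [::].
Proof.
case: w => [|a v] g; first by apply: PassEnd; apply/asboolP.
by apply: (PassRead (s := [::]) (z := [:: inl (S j)]) _ (leftmost_buffer j g));
    rewrite /delta /= inE.
Qed.

Lemma leftmost_language :
  nma_language leftmost_nma = [set w | forall j, gen [:: inl (S j)] w].
Proof.
rewrite nma_languageE; apply/seteqP; split=> w.
- set nx := (fun _ => _) : 'I_n -> _.
  (* The invariant joins the claim of the current pass to the memberships checked by all later
     passes. *)
  suff H j q v x : mp_acc delta nx (leftmost_end ord_max) w j q v x ->
      leftmost_val j q v x /\ forall i : 'I_n.+1, j < i -> gen [:: inl (S i)] w.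
    move=> /H[[_ g0] gS] i; have [->|] := eqVneq i ord0 => //.
    by rewrite -lt0n => /gS.
  elim=> {j q v x} [j q a v x q' z d _ [IH IH']|j q v x q' z d _ [IH IH']|
      j q x q' + _ [IH IH']|q x e].
  + by split=> //; apply: leftmost_read_val d IH.
  + by split=> //; apply: leftmost_eps_val d IH.
  + rewrite /nx /= inE => /andP[e /eqP Eq']; split; first exact: leftmost_end_val.
    move=> i ji; have [->|ij] := eqVneq i (lift ord0 j).
      by move: IH; rewrite Eq' => -[].
    by apply: IH'; rewrite ltn_neqAle lift0 ji andbT -lift0 eq_sym.
  + split; first exact: leftmost_end_val.
    by move=> i; rewrite ltnNge -ltnS ltn_ord.
- move=> gw; suff H m : forall j : 'I_n.+1, j + m = n -> mp_acc delta
      (fun j q g q' => q' \in nma_next (n := leftmost_nma) j q g)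
      (leftmost_end ord_max) w j None w [::] by apply: (H n); rewrite add0n.
  elim: m => [|m IH] j jm.
    have -> : j = ord_max by apply: ord_inj; rewrite -(addn0 j).
    exact/mp_acc_max/leftmost_pass.
  have jn : j < n by have := leq_addr m j.+1; rewrite addSnnS jm.
  have -> : j = widen_ord (leqnSn n) (Ordinal jn) by apply/val_inj.
  apply/mp_acc_widen; exists None; last first.
    by apply: IH; rewrite lift0 addSn -addnS.
  have := leftmost_pass (gw (widen_ord (leqnSn n) (Ordinal jn))).
  congr pass_acc; apply/funext => p; apply/funext => g /=.
  by rewrite inE eqxx andbT.
Qed.

End Leftmost_automaton.

Lemma PCF_NM (A : finType) : PCF A `<=` NM A.
Proof.
suff H n (F : 'I_n.+1 -> set (seq A)) :
    (forall i, context_free (F i)) -> NM A (\bigcap_i F i).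
  move=> _ [[|n] [F [CF ->]]]; last exact: H.
  (* An automaton makes at least one pass, so the empty intersection is written with the single
     language of all words. *)
  have -> : \bigcap_i F i = \bigcap_(i in [set: 'I_1]) [set: seq A].
    by apply/seteqP; split=> w _ // [].
  by apply: H => _; apply: context_free_setT.
move=> CF; have /choice[G GF] : forall i, exists G : cfg A,
    F i = [set w | gen [:: inl (cfg_start G)] w] by move=> i; apply/context_freeP.
(* The passes share one stack alphabet, hence the sum grammar; pass [i] starts from the start symbol
   of [G i]. *)
exists (@leftmost_nma A (sum_cfg G) n (sum_start G)).
rewrite leftmost_language; apply/seteqP; split=> w.
  by move=> Fw i; apply/gen_sum_start; have := Fw i Logic.I; rewrite GF.
by move=> gw i _; rewrite GF; apply/gen_sum_start.
Qed.

(** * Deterministic multipass languages are in the Boolean closure *)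

(* Acceptance of a pass depends on the topmost symbol and on the absence of an
   epsilon-move.  When no epsilon-move is left, the automaton therefore moves
   from [inl p] to [inr (p, g)], which also records the topmost symbol [g]. *)
Section Pass_dpda.
Variables (A Q Gamma : finType).
Variable d : Q -> option A -> option Gamma -> option (Q * seq Gamma).
Hypothesis d_det : forall q g, d q None g <> None -> forall a, d q (Some a) g = None.
Variable K : Q -> option Gamma -> Prop.

Let push (g : option Gamma) (m : Q * seq Gamma) :
    (Q + Q * option Gamma) * seq (option Gamma) :=
  (inl m.1, marked_push g m.2).

Definition pass_dpda_delta (q : Q + Q * option Gamma) (a : option A)
    (g : option Gamma) : option ((Q + Q * option Gamma) * seq (option Gamma)) :=
  match q, a with
  | inl p, None => if d p None g is Some m then Some (push g m)
                   else Some (inr (p, g), [:: g])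
  | inr (p, _), Some _ => omap (push g) (d p a g)
  | _, _ => None
  end.

Definition pass_dpda (q0 : Q) : dpda A.
Proof.
refine (@Dpda A (Q + Q * option Gamma)%type (option Gamma) pass_dpda_delta
  (inl q0) None (finset (fun q => if q is inr (p, g) then `[< K p g >] else false)) _).
by move=> [q|[q g']].
Defined.

Let pass := pass_acc (fun q a g p => d q a g = Some p)
  (fun q g => d q None g = None /\ K q g).

Lemma dpda_language_pass q0 : dpda_language (pass_dpda q0) = [set w | pass q0 w [::]].
Proof.
apply/seteqP; split=> w.
- move=> [q [x [qF steps]]].
  (* An [inr] state is entered only with top [g] and no epsilon-move; [P] assumes both, as the end
     of the pass requires them. *)
  pose P (c : dpda_state (pass_dpda q0) * seq A * seq (option Gamma)) :=
    match c with
    | (inl p, v, y) => forall s, y = marked s -> pass p v s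
    | (inr (p, g), v, y) => forall s, y = marked s -> g = ohead s ->
        d p None g = None -> pass p v s
    end.
  suff : P (inl q0, w, [:: None]) by apply.
  apply: (clos_rt_backward (P := P)) steps _ => [_ _ []|].
  + move=> [p|[p h]] a v g y q' z //=; case E: (d p (Some a) g) => [[r t]|] //=.
    move=> [<- <-] IH s; rewrite marked_ohead => -[Eg Ey] Eh dp; subst g y.
    by apply: PassRead E _; apply: IH; rewrite marked_cat.
  + move=> [p|[p h]] v g y q' z //=; case E: (d p None g) => [[r t]|] [<- <-] IH s.
      rewrite marked_ohead => -[Eg Ey]; subst g y.
      by apply: PassEps E _; apply: IH; rewrite marked_cat.
    by move=> Ey; apply: IH => //; move: Ey; rewrite marked_ohead => -[->].
  + move: qF; rewrite inE; case: q => [//|[p g]] /asboolP Kp s _ Eg dp.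
    by apply: PassEnd; rewrite -Eg.
- suff H p v s : pass p v s -> exists q y, q \in dpda_final (pass_dpda q0) /\
      clos_refl_trans _ (@dpda_step A (pass_dpda q0)) (inl p, v, marked s) (q, [::], y).
    exact: H.
  elim=> {p v s} [q s [dq Kq]|q a v s q' z dq _ [qf [y [qF IH]]]|
      q v s q' z dq _ [qf [y [qF IH]]]].
  + exists (inr (q, ohead s)), (marked s); split; first by rewrite inE; apply/asboolP.
    apply: rt_step; rewrite marked_ohead.
    by apply: (@DpdaEps _ (pass_dpda q0) _ _ _ _ _ [:: ohead s]); rewrite /= dq.
  + exists qf, y; split=> //.
    have dq0 : d q None (ohead s) = None.
      by apply: contrapT => /d_det/(_ a); rewrite dq.
    apply: (@clos_rt_cons _ _ _ (inr (q, ohead s), a :: v, marked s)).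
      rewrite marked_ohead.
      by apply: (@DpdaEps _ (pass_dpda q0) _ _ _ _ _ [:: ohead s]); rewrite /= dq0.
    apply: clos_rt_cons IH; rewrite marked_cat marked_ohead.
    by apply: DpdaRead; rewrite /= dq.
  + exists qf, y; split=> //.
    apply: clos_rt_cons IH; rewrite marked_cat marked_ohead.
    by apply: DpdaEps; rewrite /= dq.
Qed.

End Pass_dpda.

Section BDC_closure.
Variable A : finType.

Lemma BDC_closed : boolean_closed (BDC A).
Proof.
split.
- by move=> C [[]].
- by move=> C [[]].
- by move=> K L BK BL C CC; have [[_ _ CU _ _] _] := CC; apply: CU; [apply: BK|apply: BL].
- by move=> K L BK BL C CC; have [[_ _ _ CI _] _] := CC; apply: CI; [apply: BK|apply: BL].
- by move=> L BL C CC; have [[_ _ _ _ CN] _] := CC; apply: CN; apply: BL.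
Qed.

Lemma BDC_dcfl L : deterministic_context_free L -> BDC A L.
Proof. exact: sub_gen_smallest. Qed.

End BDC_closure.

Lemma DM_BDC (A : finType) : DM A `<=` BDC A.
Proof.
have [B0 _ BU BI _] := BDC_closed A.
move=> _ [M ->]; rewrite dma_languageE; apply: mp_language_in => // [q|j q q'];
  apply: BDC_dcfl.
- exists (pass_dpda (dma_delta (d := M) ord_max) (fun q g => dma_halt q g) q).
  by rewrite dpda_language_pass //; apply: dma_deterministic.
- exists (pass_dpda (dma_delta (d := M) (widen_ord (leqnSn _) j))
    (fun p g => dma_next j p g = q') q).
  by rewrite dpda_language_pass //; apply: dma_deterministic.
Qed.

(** * The Boolean closure consists of deterministic multipass languages *)

Section Dpda_acceptance.
Variables (A : finType) (M : dpda A).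
Notation Q := (dpda_state M).
Notation Gamma := (dpda_stack M).
Notation delta := (@dpda_delta A M).

(** Once the input is read, [DaccEnd] may apply between two epsilon-moves: any final state on the
    way accepts. *)
Inductive dacc : Q -> seq A -> seq Gamma -> Prop :=
| DaccEnd q s : q \in dpda_final M -> dacc q [::] s
| DaccRead q a v X s q' z : delta q (Some a) X = Some (q', z) ->
    dacc q' v (z ++ s) -> dacc q (a :: v) (X :: s)
| DaccEps q v X s q' z : delta q None X = Some (q', z) ->
    dacc q' v (z ++ s) -> dacc q v (X :: s).

Lemma dpda_languageE :
  dpda_language M = [set w | dacc (dpda_start M) w [:: dpda_bottom M]].
Proof.
apply/seteqP; split=> w /=.
- move=> [q [s [qF steps]]].
  pose P (c : Q * seq A * seq Gamma) := dacc c.1.1 c.1.2 c.2.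
  apply: (clos_rt_backward (P := P)) steps _ => [_ _ []|].
  + by move=> q0 a v X s0 q1 z; apply: DaccRead.
  + by move=> q0 v X s0 q1 z; apply: DaccEps.
  + exact: DaccEnd.
- suff H q v s : dacc q v s -> exists q' s', q' \in dpda_final M /\
      clos_refl_trans _ (@dpda_step A M) (q, v, s) (q', [::], s') by exact: H.
  elim=> {q v s} [q s qF|q a v X s q' z d _ [qf [t [qF IH]]]|
      q v X s q' z d _ [qf [t [qF IH]]]].
  + by exists q, s; split=> //; apply: rt_refl.
  + by exists qf, t; split=> //; apply: clos_rt_cons IH; apply: DpdaRead.
  + by exists qf, t; split=> //; apply: clos_rt_cons IH; apply: DpdaEps.
Qed.

Lemma dacc_nil q v : dacc q v [::] <-> v = [::] /\ q \in dpda_final M.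
Proof.
split=> [acc|[-> qF]]; last exact: DaccEnd.
by inversion acc.
Qed.

Lemma dacc_eps q v X s q' z : delta q None X = Some (q', z) ->
  dacc q v (X :: s) <-> (v = [::] /\ q \in dpda_final M) \/ dacc q' v (z ++ s).
Proof.
move=> d; split=> [acc|[[-> qF]|]]; [|exact: DaccEnd|exact: DaccEps].
inversion acc as [? ? ?|? a ? ? ? ? ? da|? ? ? ? ? ? d']; subst; first by left.
- by rewrite dpda_deterministic ?d in da.
- by move: d'; rewrite d => -[-> ->]; right.
Qed.

Lemma dacc_stable_nil q X s : delta q None X = None ->
  dacc q [::] (X :: s) <-> q \in dpda_final M.
Proof.
move=> d; split=> [acc|]; last exact: DaccEnd.
by inversion acc as [| |? ? ? ? ? ? d']; subst; [|rewrite d in d'].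
Qed.

Lemma dacc_stable_cons q a v X s : delta q None X = None ->
  dacc q (a :: v) (X :: s) <->
  if delta q (Some a) X is Some (q', z) then dacc q' v (z ++ s) else False.
Proof.
move=> d; split=> [acc|].
  inversion acc as [|? ? ? ? ? ? ? da|? ? ? ? ? ? d']; subst; first by rewrite da.
  by rewrite d in d'.
by case E: (delta _ _ _) => [[q' z]|] //; apply: DaccRead.
Qed.

(* [eps_run q s b q' s']: the configuration [(q, s)] reaches [(q', s')] by
   epsilon-moves, and [b] tells whether a configuration before the last one was
   in a final state. *)
Inductive eps_run : Q -> seq Gamma -> bool -> Q -> seq Gamma -> Prop :=
| EpsRefl q s : eps_run q s false q s
| EpsStep q X s q1 z b q' s' : delta q None X = Some (q1, z) ->
    eps_run q1 (z ++ s) b q' s' ->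
    eps_run q (X :: s) ((q \in dpda_final M) || b) q' s'.

Definition stable q (s : seq Gamma) : bool :=
  if s is X :: _ then delta q None X == None else true.

Lemma eps_run_rcons q s b q1 X t q2 z : eps_run q s b q1 (X :: t) ->
  delta q1 None X = Some (q2, z) -> exists b', eps_run q s b' q2 (z ++ t).
Proof.
move Ey: (X :: t) => y r; elim: r Ey => {q s b q1 y} [q y <-|
    q Y s q1 z' b q' s' d _ IH Ey] d2.
  by exists ((q \in dpda_final M) || false); apply: EpsStep d2 (EpsRefl _ _).
have [b' r] := IH Ey d2.
by exists ((q \in dpda_final M) || b'); apply: EpsStep d r.
Qed.

(** The moves act on [s] whatever lies below; [b] accounts for acceptance in a final state passed on
    the way. *)
Lemma dacc_eps_run q s b q' s' r v : eps_run q s b q' s' ->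
  dacc q v (s ++ r) <-> (b /\ v = [::]) \/ dacc q' v (s' ++ r).
Proof.
elim=> {q s b q' s'} [q s|q X s q1 z b q' s' d _ IH].
  by split=> [|[[]|]] //; right.
rewrite (dacc_eps _ _ d) catA IH; split.
  move=> [[-> ->]|[[-> ->]|]]; [by left|by left; rewrite orbT|by right].
by move=> [[/orP[?|?] ->]|?]; [left|right; left|right; right].
Qed.

(** An empty stack is stable, so the endless epsilon-moves never expose [s], and determinism
    excludes reading a letter meanwhile. *)
Lemma dacc_diverge q X v s :
  (forall b q' t, eps_run q [:: X] b q' t -> ~~ stable q' t) ->
  dacc q v (X :: s) <->
  v = [::] /\ exists b q' t, eps_run q [:: X] b q' t /\ q' \in dpda_final M.
Proof.
move=> div; split=> [|[-> [b [q' [t [r qF]]]]]]; last first.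
  by apply/(dacc_eps_run s [::] r); right; apply: DaccEnd.
suff H q1 y : dacc q1 v y -> forall b t, y = t ++ s -> eps_run q [:: X] b q1 t ->
    v = [::] /\ exists b q' t, eps_run q [:: X] b q' t /\ q' \in dpda_final M.
  by move=> /H/(_ false [:: X]); apply=> //; apply: EpsRefl.
elim=> {q1 v y} [q1 y qF|q1 a v Y y q' z d _ _|q1 v Y y q' z d _ IH] b [|Z t] // Ey r;
  try by have := div _ _ _ r.
- by split=> //; exists b, q1, (Z :: t).
- case: Ey => EY _; subst Z; have /= := div _ _ _ r.
  by move=> /eqP /dpda_deterministic /(_ a); rewrite d.
- case: Ey => EY Ey; subst Z; have [b' r'] := eps_run_rcons r d.
  by apply: IH r'; rewrite Ey catA.
Qed.

End Dpda_acceptance.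

(** * Disjoint unions of deterministic pushdown automata *)

Section Sum_dpda.
Variables (A I : finType) (D : I -> dpda A) (i0 : I).
Notation tagQ := (Tagged (fun i => dpda_state (D i))).
Notation tagG := (Tagged (fun i => dpda_stack (D i))).

(** One machine, started in different configurations, thus simulates every [D i]. State and stack
    symbol interact only if their tags agree, which permits the cast. *)
Definition sum_dpda_delta (u : {i : I & dpda_state (D i)}) (a : option A)
    (x : {i : I & dpda_stack (D i)}) :
    option ({i : I & dpda_state (D i)} * seq {i : I & dpda_stack (D i)}) :=
  match tag u =P tag x with
  | ReflectT e =>
      omap (fun m => (tagQ m.1,
                      map tagG m.2))
        (dpda_delta (tagged u) a (ecast i (dpda_stack (D i)) (esym e) (tagged x)))
  | ReflectF _ => None
  end.

Lemma sum_dpda_deltaE i (q : dpda_state (D i)) a (X : dpda_stack (D i)) :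
  sum_dpda_delta (tagQ q) a
    (tagG X) =
  omap (fun m => (tagQ m.1,
                  map tagG m.2))
    (dpda_delta q a X).
Proof. by rewrite /sum_dpda_delta; case: eqP => // e; rewrite eq_axiomK. Qed.

Definition sum_dpda : dpda A.
Proof.
refine (@Dpda A {i : I & dpda_state (D i)} {i : I & dpda_stack (D i)}
  sum_dpda_delta (tagQ (dpda_start (D i0))) (tagG (dpda_bottom (D i0)))
  (finset (fun u => tagged u \in dpda_final (D (tag u)))) _).
move=> u x; rewrite /sum_dpda_delta; case: eqP => // e.
set X := ecast _ _ _ _; case E: (dpda_delta _ None X) => [m|] // _ a.
by rewrite dpda_deterministic ?E.
Defined.

Lemma dacc_sum_dpda i (q : dpda_state (D i)) v s :
  dacc (M := sum_dpda) (tagQ q) v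
    (map tagG s) <-> dacc q v s.
Proof.
split.
- move Eu: (tagQ q) => u; move Ey: (map _ s) => y acc.
  elim: acc q s Eu Ey => {u v y} [u y uF|u a v x y u' z d _ IH|
      u v x y u' z d _ IH] q s Eu;
    subst u.
  + by move=> _; apply: DaccEnd; move: uF; rewrite inE.
  + case: s => //= X s [EX Ey]; subst x y.
    move: d; rewrite /= sum_dpda_deltaE; case E: (dpda_delta _ _ _) =>
        [[q' z']|] //= [Eu Ez].
    by apply: DaccRead E _; apply: IH => //; rewrite map_cat Ez.
  + case: s => //= X s [EX Ey]; subst x y.
    move: d; rewrite /= sum_dpda_deltaE; case E: (dpda_delta _ _ _) =>
        [[q' z']|] //= [Eu Ez].
    by apply: DaccEps E _; apply: IH => //; rewrite map_cat Ez.
- elim=> {q v s} [q s qF|q a v X s q' z d _ IH|q v X s q' z d _ IH].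
  + by apply: DaccEnd; rewrite inE.
  + rewrite map_cat in IH; apply: DaccRead IH.
    by rewrite /= sum_dpda_deltaE d.
  + rewrite map_cat in IH; apply: DaccEps IH.
    by rewrite /= sum_dpda_deltaE d.
Qed.

End Sum_dpda.

(* One pass of the automaton below decides, for each word, whether the DPDA [M]
   accepts it when started in [(conf j).1] with stack [:: (conf j).2], and it
   always terminates: a maximal sequence of epsilon-moves that starts from one
   stack symbol is performed in a single move if it is finite (its effect being
   given by [res]), and it is replaced by a move to a sink if it is infinite.
   In a state [Some (inl (q, b))], the automaton simulates [M] in state [q], and
   [b] tells whether [M] met a final state since the last letter was read; in
   [Some (inr b)], the sink, [M] accepts the word read so far iff [b] holds.
   The state [None] is the initial one: the empty stack allows no epsilon-move,
   so that the initial moves of [M] are performed while the first letter is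
   read. *)
Section Decider.
Variables (A : finType) (M : dpda A) (n : nat).
Notation Q := (dpda_state M).
Notation Gamma := (dpda_stack M).
Notation delta := (@dpda_delta A M).
Variable conf : 'I_n.+1 -> Q * Gamma.
Variable res : Q -> Gamma -> option (Q * bool * seq Gamma).
Hypothesis resP : forall q X,
  match res q X with
  | Some (q', b, t) => eps_run q [:: X] b q' t /\ stable q' t
  | None => forall b q' t, eps_run q [:: X] b q' t -> ~~ stable q' t
  end.
Variable f : {ffun 'I_n.+1 -> bool} -> bool.

Let local := option (Q * bool + bool).
Let stack := (Gamma + A)%type.

Definition sink : local * seq stack := (Some (inr false), [::]).

(** The word [t] serves the first move, where the stack left below [X] by the initial epsilon-moves
    has to be pushed together with [z]. *)
Definition decider_read (a : A) (q : Q) (X : Gamma) (t : seq Gamma) :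
    local * seq stack :=
  if delta q (Some a) X is Some (q', z) then
    (Some (inl (q', false)), map inl (z ++ t))
  else sink.

Definition diverge_final (q : Q) (X : Gamma) : bool :=
  `[< exists b q' t, eps_run q [:: X] b q' t /\ q' \in dpda_final M >].

Definition decider_delta (j : 'I_n.+1) (l : local) (a : option A)
    (g : option stack) : option (local * seq stack) :=
  match l, a, g with
  | None, Some a, None => Some
      (if res (conf j).1 (conf j).2 is Some (q', _, Y :: t) then decider_read a q' Y t
       else sink)
  | Some (inl (q, b)), None, Some (inl X) =>
      if delta q None X == None then None
      else if res q X is Some (q', b', t) then
        Some (Some (inl (q', b || b')), map inl t)
      else Some (Some (inr (b || diverge_final q X)), [::])
  | Some (inl (q, _)), Some a, Some (inl X) =>
      if delta q None X == None then Some (decider_read a q X [::]) else None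
  | _, Some _, _ => Some sink
  | _, None, _ => None
  end.

Definition decider_out (j : 'I_n.+1) (l : local) : bool :=
  match l with
  | None => `[< dacc (conf j).1 [::] [:: (conf j).2] >]
  | Some (inl (q, b)) => b || (q \in dpda_final M)
  | Some (inr b) => b
  end.

(** The verdict that the pass owes when [v] is left to read; moves preserve it, and [decider_out]
    agrees with it at the end. *)
Definition decider_val (j : 'I_n.+1) (l : local) (v : seq A) (s : seq Gamma) : Prop :=
  match l with
  | None => dacc (conf j).1 v [:: (conf j).2]
  | Some (inl (q, b)) => (b /\ v = [::]) \/ dacc q v s
  | Some (inr b) => b /\ v = [::]
  end.

Definition reachable (l : local) (s : seq Gamma) : Prop := l = None -> s = [::].

Let top (s : seq Gamma) : option stack := ohead (map inl s).

Lemma decider_read_val j a q X t v s : delta q None X = None ->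
  exists2 s', (decider_read a q X t).2 ++ map inl s = map inl s' &
    (decider_read a q X t).1 <> None /\
    (dacc q (a :: v) (X :: t ++ s) <-> decider_val j (decider_read a q X t).1 v s').
Proof.
move=> /(dacc_stable_cons a v (t ++ s)); rewrite /decider_read.
case: (delta _ _ _) => [[q' z]|] /= V.
  exists (z ++ t ++ s); first by rewrite !map_cat catA.
  by split=> //; rewrite V; split=> [|[[]|]] //; right.
by exists s => //; split=> //; rewrite V; split=> // -[].
Qed.

Lemma decider_delta_read j l a v s l' z : reachable l s ->
  decider_delta j l (Some a) (top s) = Some (l', z) ->
  exists2 s', z ++ behead (map inl s) = map inl s' &
    l' <> None /\ (decider_val j l (a :: v) s <-> decider_val j l' v s').
Proof.
case: l => [[[q b]|b]|] reach.
- case: s {reach} => [|X s] /=.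
    move=> [<- <-]; exists [::] => //; split=> //=; rewrite dacc_nil.
    by split=> [[[]|[]]|[]].
  case: eqP => // d [E].
  have := decider_read_val j a [::] v s d; rewrite E /= => -[s' Es [nz V]].
  exists s' => //; split=> //; rewrite -V.
  by split=> [[[]|]|] //; right.
- move=> E; have {E} [<- <-] : Some sink = Some (l', z) by rewrite -E; case: (top s) =>
    [[]|].
  by exists (behead s); rewrite ?behead_map //; split=> //; split=> -[].
- rewrite (reach erefl) /= cats0; have := resP (conf j).1 (conf j).2.
  case: (res _ _) => [[[q' b'] [|Y t]] [r st] [E]|div [<- <-]].
  + case: E => <- <-; exists [::] => //; split=> //=; have /= -> := dacc_eps_run
      [::] (a :: v) r; rewrite dacc_nil.
    by split=> [[[]|[]]|[]].
  + have := decider_read_val j a t v [::] (eqP st).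
    rewrite E /= !cats0 => -[s' Es [nz V]]; exists s' => //; split=> //.
    have := dacc_eps_run [::] (a :: v) r; rewrite /= cats0 => ->; rewrite -V; split=>
        [[[]|]|] //; by right.
  + exists [::] => //; split=> //=; rewrite (dacc_diverge _ _ div).
    by split=> -[].
Qed.

(** The last disjunct gives termination: a maximal run either pops its symbol, shrinking the stack,
    or leaves a stable symbol on top. *)
Lemma decider_delta_eps j l v s l' z : reachable l s ->
  decider_delta j l None (top s) = Some (l', z) ->
  exists2 s', z ++ behead (map inl s) = map inl s' &
    [/\ l' <> None, decider_val j l v s <-> decider_val j l' v s'
      & size s' < size s \/ decider_delta j l' None (top s') = None].
Proof.
case: l s => [[[q b]|b]|] [|X s] // _ /=; case: eqP => // d.
have := resP q X; case: (res q X) => [[[q' b'] t] [r st] [<- <-]|div [<- <-]].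
- exists (t ++ s); first by rewrite map_cat.
  split=> //.
    have /= -> := dacc_eps_run s v r; split.
      by move=> [[-> ->]|[[-> ->]|]]; [left|left; rewrite orbT|right].
    by move=> [[/orP[?|?] ->]|?]; [left|right; left|right; right].
  by case: t st {r} => [|Y t] /= st; [left|right; rewrite st].
- exists s => //; split=> //; last by left.
  rewrite /= (dacc_diverge v s div); split.
    move=> [[-> ->]|[-> D]] //; split=> //; apply/orP; right; exact/asboolP.
  by move=> [/orP[?|/asboolP D] ->]; [left|right].
Qed.

Lemma decider_out_val j l s : reachable l s ->
  decider_delta j l None (top s) = None ->
  decider_out j l = `[< decider_val j l [::] s >].
Proof.
move=> reach; case: l reach => [[[q b]|b]|] reach //= d; apply/esym.
- apply/asboolP/orP; last first.
    by move=> [?|?]; [left|right; apply: DaccEnd].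
  move=> [[]|]; first by left.
  case: s d {reach} => [_ /dacc_nil[]|X s /=]; first by right.
  case: eqP => [d _ /(dacc_stable_nil _ d)|_]; first by right.
  by case: (res _ _) => [[[]]|].
- by apply/asboolP/idP => [[]|].
Qed.

Lemma decider_delta_total j l g : decider_delta j l None g = None ->
  forall a, decider_delta j l (Some a) g <> None.
Proof.
case: l g => [[[q b]|b]|] [[X|c]|] //=.
by case: eqP => // _; case: (res _ _) => [[[]]|].
Qed.

Lemma decider_delta_det j l g : decider_delta j l None g <> None ->
  forall a, decider_delta j l (Some a) g = None.
Proof. by case: l g => [[[q b]|b]|] [[X|c]|] //=; case: eqP. Qed.

Let state := ({ffun 'I_n.+1 -> bool} * local)%type.

Let dma_d (j : 'I_n.+1) (q : state) a g :=
  omap (fun m : local * seq stack => ((q.1, m.1), m.2)) (decider_delta j q.2 a g).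

Let record (j : 'I_n.+1) (q : state) : {ffun 'I_n.+1 -> bool} :=
  [ffun i => if i == j then decider_out j q.2 else q.1 i].

Definition decider_dma : dma A.
Proof.
refine (@Dma A n state stack inr _ dma_d
  (fun j q _ => (record (widen_ord (leqnSn n) j) q, None))
  (fun q _ => f (record ord_max q)) ([ffun=> false], None) _ _ _).
- by move=> a b [].
- by move=> j [r [[[q b]|b]|]].
- move=> j [r l] g; rewrite /dma_d /= => d a; rewrite decider_delta_det //.
  by move=> E; rewrite E in d.
- move=> j [r l] g; rewrite /dma_d /= => d a.
  have := @decider_delta_total j l g _ a; case: (decider_delta j l None g) d => // _.
  by case: (decider_delta j l (Some a) g) => // /(_ erefl).
Defined.

Lemma decider_pass j r l v s : reachable l s ->
  pass_acc (fun q a g p => dma_d j q a g = Some p)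
    (fun q g => [/\ dma_d j q None g = None, q.1 = r
       & decider_out j q.2 = `[< decider_val j l v s >]]) (r, l) v (map inl s).
Proof.
set P := pass_acc _.
pose K l v s (q : state) g := [/\ dma_d j q None g = None, q.1 = r
  & decider_out j q.2 = `[< decider_val j l v s >]].
suff H : forall v l s, reachable l s -> P (K l v s) (r, l) v (map inl s) by exact: H.
(* Induction on the stack size reduces the claim to configurations without epsilon-moves. *)
move=> {v l s}; have eps_closed v :
    (forall l s, reachable l s -> decider_delta j l None (top s) = None ->
       P (K l v s) (r, l) v (map inl s)) ->
    forall l s, reachable l s -> P (K l v s) (r, l) v (map inl s).
  move=> st l s; have [m] := ubnP (size s); elim: m l s => // m IH l s sm reach.
  case E: (decider_delta j l None (top s)) => [[l' z]|]; last exact: st.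
  have [s' Es [nz V M']] := decider_delta_eps v reach E.
  apply: (PassEps (q' := (r, l')) (z := z)); first by rewrite /dma_d /= E.
  rewrite Es -/P /K (propext V).
  case: M' => [s's|d]; last by apply: st.
  by apply: IH => //; apply: leq_trans s's sm.
elim=> [|a v IH]; apply: eps_closed => l s reach d.
- by apply: PassEnd; split=> //=; [rewrite /dma_d /= d | apply: decider_out_val].
- have := @decider_delta_total _ _ _ d a.
  case E: (decider_delta j l (Some a) (top s)) => [[l' z]|] // _.
  have [s' Es [nz V]] := decider_delta_read v reach E.
  apply: (PassRead (q' := (r, l')) (z := z)); first by rewrite /dma_d /= E.
  by rewrite Es -/P /K (propext V); apply: IH.
Qed.

(** The final vector predicted during pass [j]: earlier bits are stored, bit [j] is [b], later bits
    are the true memberships. *)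
Let result (w : seq A) (j : 'I_n.+1) (r : {ffun 'I_n.+1 -> bool}) (b : bool) :
    {ffun 'I_n.+1 -> bool} :=
  [ffun i : 'I_n.+1 => if i < j then r i else if i == j then b
                       else `[< dacc (conf i).1 w [:: (conf i).2] >]].

Lemma result_next w (j : 'I_n) (r r' : {ffun 'I_n.+1 -> bool}) b :
  (forall i, r' i = if i == widen_ord (leqnSn n) j then b else r i) ->
  result w (lift ord0 j) r'
    `[< dacc (conf (lift ord0 j)).1 w [:: (conf (lift ord0 j)).2] >] =
  result w (widen_ord (leqnSn n) j) r b.
Proof.
move=> Er; apply/ffunP => i; rewrite !ffunE Er -!val_eqE /= /bump leq0n add1n ltnS.
case: (ltngtP i j) => // ji; case: eqP => // Ei.
by have -> : i = lift ord0 j by apply: ord_inj; rewrite lift0.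
Qed.

Lemma result_max w q b : decider_out ord_max q.2 = b ->
  record ord_max q = result w ord_max q.1 b.
Proof.
move=> Eb; apply/ffunP => i; rewrite !ffunE -!val_eqE /= Eb.
by case: (ltngtP i n) => //; rewrite ltnNge -ltnS ltn_ord.
Qed.

Lemma decider_language : dma_language decider_dma =
  [set w | f [ffun i => `[< dacc (conf i).1 w [:: (conf i).2] >]]].
Proof.
have result0 w r : result w ord0 r `[< dacc (conf ord0).1 w [:: (conf ord0).2] >] =
    [ffun i => `[< dacc (conf i).1 w [:: (conf i).2] >]].
  by apply/ffunP => i; rewrite !ffunE ltn0; case: eqP => // ->.
rewrite dma_languageE; apply/seteqP; split=> w /=; last first.
- move=> fw; set nx := (fun _ => _) : 'I_n -> _; set hl := (fun _ => _) : state -> _.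
  suff H m : forall (j : 'I_n.+1) r, j + m = n ->
      f (result w j r `[< dacc (conf j).1 w [:: (conf j).2] >]) ->
      mp_acc (fun j q a g p => dma_d j q a g = Some p) nx hl w j (r, None) w [::].
    by apply: (H n); rewrite ?add0n // result0.
  elim: m => [|m IH] j r jm.
    have -> : j = ord_max by apply: ord_inj; rewrite -(addn0 j).
    move=> fr; apply/mp_acc_max.
    have reach : reachable None [::] by [].
    apply: pass_acc_sub (decider_pass ord_max r w reach) => q g [d Er Eo].
    by split=> //=; rewrite (result_max w Eo) Er.
  have jn : j < n by have := leq_addr m j.+1; rewrite addSnnS jm.
  pose j' := Ordinal jn.
  have Ej : j = widen_ord (leqnSn n) j' by apply/val_inj.
  rewrite Ej => fr; apply/mp_acc_widen.
  set b := `[< _ >] in fr.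
  exists ([ffun i => if i == widen_ord (leqnSn n) j' then b else r i], None).
    have reach : reachable None [::] by [].
    apply: pass_acc_sub (decider_pass _ r w reach) => q g [d Er Eo].
    by split=> //=; rewrite /record Eo Er.
  apply: IH; first by rewrite lift0 addSn -addnS.
  by rewrite (result_next w (r := r) (b := b)) // => i; rewrite ffunE.
- set nx := (fun _ => _) : 'I_n -> _; set hl := (fun _ => _) : state -> _.
  (* The predicted vector never changes along the computation; by [result0] it starts as the
     membership vector of [w]. *)
  suff H j q v y :
      mp_acc (fun j q a g p => dma_d j q a g = Some p) nx hl w j q v y ->
      forall s, y = map inl s -> reachable q.2 s ->
      f (result w j q.1 `[< decider_val j q.2 v s >]).
    by move=> /H/(_ [::] erefl); rewrite result0; apply.
  elim=> {j q v y} [j q a v y q' z|j q v y q' z|j q y q' [d <-] _ IH|q y [d fr]] /=.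
  + rewrite /dma_d; case E: (decider_delta j q.2 (Some a) (ohead y)) => [[l' z']|] //=.
    move=> [<- <-] _ IH s Ey reach; subst y.
    have [s' Es [nz V]] := decider_delta_read v reach E.
    by rewrite (propext V); apply: IH.
  + rewrite /dma_d; case E: (decider_delta j q.2 None (ohead y)) => [[l' z']|] //=.
    move=> [<- <-] _ IH s Ey reach; subst y.
    have [s' Es [nz V _]] := decider_delta_eps v reach E.
    by rewrite (propext V); apply: IH.
  + move=> s Ey reach; subst y; have := IH [::] erefl (fun=> erefl).
    rewrite (result_next w (r := q.1)
      (b := `[< decider_val (widen_ord (leqnSn n) j) q.2 [::] s >])) // => i.
    rewrite ffunE (decider_out_val reach) //.
    by move: d; rewrite /dma_d; case: (decider_delta _ _ _ _).
  + move=> s Ey reach; subst y; rewrite -(@result_max w q) //.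
    apply: decider_out_val reach _.
    by move: d; rewrite /= /dma_d; case: (decider_delta _ _ _ _).
Qed.

End Decider.

Lemma DM_determined (A : finType) n (D : 'I_n.+1 -> dpda A) (L : set (seq A)) :
  (forall w w', (forall i, dpda_language (D i) w <-> dpda_language (D i) w') ->
     L w -> L w') ->
  DM A L.
Proof.
move=> LD.
pose M := sum_dpda D ord0.
pose conf (i : 'I_n.+1) : dpda_state M * dpda_stack M :=
  (Tagged (fun i => dpda_state (D i)) (dpda_start (D i)),
   Tagged (fun i => dpda_stack (D i)) (dpda_bottom (D i))).
have confP i w : dacc (conf i).1 w [:: (conf i).2] <-> dpda_language (D i) w.
  rewrite dpda_languageE.
  exact: (dacc_sum_dpda ord0 (dpda_start (D i)) w [:: dpda_bottom (D i)]).
(* The outcomes of maximal epsilon-runs form a finite table built into the automaton, so their mere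
   existence suffices. *)
have /choice[res resP] : forall qX : dpda_state M * dpda_stack M,
    exists r : option (dpda_state M * bool * seq (dpda_stack M)), match r with
    | Some (q', b, t) => eps_run qX.1 [:: qX.2] b q' t /\ stable q' t
    | None => forall b q' t, eps_run qX.1 [:: qX.2] b q' t -> ~~ stable q' t
    end.
  move=> [q X]; have [[[[q' b] t] P]|div] := EM (exists r :
      dpda_state M * bool * seq (dpda_stack M),
      eps_run q [:: X] r.1.2 r.1.1 r.2 /\ stable r.1.1 r.2).
    by exists (Some (q', b, t)).
  exists None => /= b q' t r; apply/negP => st; apply: div.
  by exists (q', b, t).
(* Accepts the membership vectors of words of [L]; by [LD] every word with such a vector is in
   [L]. *)
pose f (r : {ffun 'I_n.+1 -> bool}) :=
  `[< exists2 w, L w & r = [ffun i => `[< dacc (conf i).1 w [:: (conf i).2] >]] >].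
exists (decider_dma conf (fun q X => res (q, X)) f).
rewrite decider_language; last by move=> q X; apply: (resP (q, X)).
apply/seteqP; split=> w /=; first by move=> Lw; apply/asboolP; exists w.
move=> /asboolP[w' Lw' /ffunP E]; apply: LD Lw' => i.
have := E i; rewrite !ffunE => Ei; have {}Ei := asbool_eq_equiv Ei.
by split=> /confP acc; apply/confP; apply/Ei.
Qed.

Lemma BDC_DM (A : finType) : BDC A `<=` DM A.
Proof.
(* Being determined by finitely many membership bits is visibly stable under Boolean operations, so
   no formula has to be recorded. *)
pose C : set (set (seq A)) := [set L | exists n (D : nat -> dpda A), forall w w',
  (forall i, i < n -> dpda_language (D i) w <-> dpda_language (D i) w') ->
  L w <-> L w'].
have CDM : C `<=` DM A.
  (* The additional automaton [D n] ensures at least one pass when [n = 0]. *)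
  move=> L [n [D LD]]; apply: (@DM_determined _ n (fun i : 'I_n.+1 => D i)) => w w' Dww'.
  by apply: (LD w w' _).1 => i lt_in; apply: (Dww' (Ordinal (leqW lt_in))).
(* Concatenating the two lists of automata determines both languages, hence any connective of
   them. *)
have C2 (op : Prop -> Prop -> Prop) K L : C K -> C L -> C [set w | op (K w) (L w)].
  move=> [m [D KD]] [n [E LE]]; exists (m + n), (fun i => if i < m then D i else E (i - m)).
  move=> w w' H /=; rewrite (propext (KD w w' _)) ?(propext (LE w w' _)) // => i lt_i.
    have := H (m + i); rewrite ltn_add2l => /(_ lt_i).
    by rewrite ltnNge leq_addr addKn.
  by have := H i; rewrite lt_i; apply; apply: ltn_addr.
apply: subset_trans CDM; apply: smallest_sub; last first.
  by move=> _ [M ->]; exists 1, (fun=> M) => w w' /(_ 0); apply.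
(* A default value for the empty list of automata. *)
pose D0 : dpda A := @Dpda A unit unit (fun _ _ _ => None) tt tt (finset pred0) (fun _ _ _ _ => erefl).
split.
- by exists 0, (fun=> D0).
- by exists 0, (fun=> D0).
- by move=> K L; apply: (C2 or).
- by move=> K L; apply: (C2 and).
- by move=> L CL; apply: (C2 (fun P _ => ~ P) L L).
Qed.

Theorem theorem2p6 (A : finType) : DM A = BDC A /\ NM A = PCF A.
Proof.
split; apply/seteqP; split; [exact: DM_BDC | exact: BDC_DM | exact: NM_PCF | exact: PCF_NM].
Qed.
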